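(* Let $R$ and $B$ be finite sets of real numbers with $|R|=n$ and $|B|=m$, and let $T^R$ and $T^B$ be $1$-dimensional range trees built on $R$ and $B$, respectively, each a weight-balanced \textsc{bb}[$\alpha$] binary search tree (for a fixed constant $\alpha$). Then the number of links between $T^R$ and $T^B$ is $O(n+m)$.
   Context: Elements are stored in the leaves; for a node $u$ its canonical subset $P_u$ is the set of elements in the leaves of its subtree. For a tree $T^S$ storing $S$ and an interval $I$, $C(T^S,I)$ denotes the minimal set of nodes whose canonical subsets together represent exactly $S\cap I$. For $u\in T^R$ let $a_u=\max P_u$ and for $v\in T^B$ let $b_v=\min P_v$. A node $u\in T^R$ and a node $v\in T^B$ are linked if and only if $v\in C(T^B,[a_u,\infty))$ and $u\in C(T^R,(-\infty,b_v])$. The constant in the $O$-bound may depend on $\alpha$. *)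

(* Defs.v *)
From HB Require Import structures.
From mathcomp Require Import all_boot all_order all_algebra.
From mathcomp Require Import finmap reals.

Set Implicit Arguments.
Unset Strict Implicit.
Unset Printing Implicit Defensive.

Import Order.TTheory GRing.Theory Num.Theory.
Local Open Scope ring_scope.

(* Leaf-oriented binary trees. Routing values at internal nodes are omitted:
   neither canonical subsets nor balance depend on them. The tree storing the
   empty set has no node, so a possibly empty tree is an [option (tree T)]. *)
Inductive tree (T : Type) : Type :=
  | Leaf of T
  | Node of tree T & tree T.

Fixpoint leaves (T : Type) (t : tree T) : seq T :=
  match t with
  | Leaf x => [:: x]
  | Node l r => leaves l ++ leaves r
  end.

Definition weight (T : Type) (t : tree T) : nat := size (leaves t).

(* A node is identified by the path leading to it from the root:
   [false] is a step to the left child, [true] a step to the right child. *)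
Fixpoint nodes (T : Type) (t : tree T) : seq (seq bool) :=
  match t with
  | Leaf _ => [:: [::]]
  | Node l r =>
      [::] :: [seq false :: p | p <- nodes l] ++ [seq true :: p | p <- nodes r]
  end.

Definition node (T : Type) (t : tree T) : finType := seq_sub (nodes t).

(* The value on a path that leaves the tree is irrelevant. *)
Fixpoint subtree_at (T : Type) (t : tree T) (p : seq bool) : tree T :=
  match t, p with
  | Node l r, b :: q => subtree_at (if b then r else l) q
  | _, _ => t
  end.

Definition subtree (T : Type) (t : tree T) (u : node t) : tree T :=
  subtree_at t (val u).

Fixpoint tree_max (K : realType) (t : tree K) : K :=
  match t with
  | Leaf x => x
  | Node l r => Num.max (tree_max l) (tree_max r)
  end.

Fixpoint tree_min (K : realType) (t : tree K) : K :=
  match t with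
  | Leaf x => x
  | Node l r => Num.min (tree_min l) (tree_min r)
  end.

Definition canonical_subset (K : realType) (t : tree K) (u : node t) : {fset K} :=
  [fset x in leaves (subtree u)]%fset.

Definition represents (K : realType) (t : tree K) (I : interval K)
    (A : {set node t}) : bool :=
  (\bigcup_(u in A) canonical_subset u)%fset == [fset x in leaves t | x \in I]%fset.

Definition min_representation (K : realType) (t : tree K) (I : interval K)
    (A : {set node t}) : bool :=
  represents I A && [forall A' : {set node t}, represents I A' ==> (#|A| <= #|A'|)%N].

(* C(t, I). Minimality is with respect to cardinality: replacing a node by its
   two children preserves minimality with respect to inclusion. A minimum always
   exists, and it is unique when the leaves of [t] are distinct. *)
Definition canonical_nodes (K : realType) (t : tree K) (I : interval K) : {set node t} :=
  odflt set0 [pick A | min_representation I A].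

Definition linked (K : realType) (tR tB : tree K) (u : node tR) (v : node tB) : bool :=
  (v \in canonical_nodes tB `[tree_max (subtree u), +oo[) &&
  (u \in canonical_nodes tR `]-oo, tree_min (subtree v)]).

Definition num_links (K : realType) (TR TB : option (tree K)) : nat :=
  match TR, TB with
  | Some tR, Some tB => #|[set uv : node tR * node tB | linked uv.1 uv.2]|
  | _, _ => 0%N
  end.

(* [T] is a binary search tree storing exactly the elements of [S] in its leaves. *)
Definition range_tree (K : realType) (S : {fset K}) (T : option (tree K)) : Prop :=
  match T with
  | None => S = fset0
  | Some t => sorted <%R (leaves t) /\ leaves t =i S
  end.

(* The root balance of Nievergelt and Reingold, computed on numbers of leaves. *)
Definition balance (K : realType) (l r : tree K) : K :=
  (weight l)%:R / (weight l + weight r)%:R.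

Fixpoint tree_bb (K : realType) (alpha : K) (t : tree K) : bool :=
  match t with
  | Leaf _ => true
  | Node l r =>
      [&& alpha <= balance l r <= 1 - alpha, tree_bb alpha l & tree_bb alpha r]
  end.

Definition bb (K : realType) (alpha : K) (T : option (tree K)) : bool :=
  if T is Some t then tree_bb alpha t else true.

(* Main.v *)
Require Import Defs.
From HB Require Import structures.
From mathcomp Require Import all_boot all_order all_algebra.
From mathcomp Require Import finmap reals ring lra.

Set Implicit Arguments.
Unset Strict Implicit.
Unset Printing Implicit Defensive.

Import Order.TTheory GRing.Theory Num.Theory.
Local Open Scope ring_scope.

(** A node of [C(t, I)] is a topmost node whose canonical subset lies in [I].
    Charge each link to the lighter of its two endpoints, say [u]. Its partners
    [v] are disjoint, have at least [|P_u|] elements each, and all but the last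
    one are contained in the set of those [b] in [B] for which [u] belongs to
    [C(T^R, (-oo, b])]. Hence [u] is charged at most [1 + N_u / |P_u|] times,
    where [N_u] is the size of that set. Summing over [u] and exchanging sums,
    each [b] contributes the sum of [1 / |P_u|] over [C(T^R, (-oo, b])], which
    is [O(1)] since the weights of these nodes decrease geometrically along a
    search path of a balanced tree. *)

(** * Paths in a tree and topmost nodes inside a predicate *)

Section Paths.
Variable T : eqType.
Implicit Types (t : tree T) (p q : seq bool).

Lemma mem_nodes_Node (l r : tree T) b p :
  (b :: p \in nodes (Node l r)) = (p \in nodes (if b then r else l)).
Proof.
have inj c : injective (cons c : seq bool -> _) by move=> x y [].
rewrite inE /= mem_cat.
have ne c s : c != b -> (b :: p \in [seq c :: p | p <- s]) = false.
  by move=> cb; apply/mapP => -[x _ [bc _]]; rewrite bc eqxx in cb.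
by case: b ne => ne; rewrite (mem_map (inj _)) ne ?orbF.
Qed.

Lemma root_nodes t : [::] \in nodes t.
Proof. by case: t => *; rewrite inE. Qed.

Lemma uniq_nodes t : uniq (nodes t).
Proof.
elim: t => // l IHl r IHr /=.
have inj c : injective (cons c : seq bool -> _) by move=> x y [].
rewrite cat_uniq !(map_inj_uniq (inj _)) IHl IHr mem_cat andbT /=.
apply/andP; split; first by apply/norP; split; apply/mapP => -[].
by apply/hasPn => _ /mapP[x _ ->]; apply/mapP => -[].
Qed.

Lemma size_nodes t : ((size (nodes t)).+1 = (weight t).*2)%N.
Proof.
elim: t => // l IHl r IHr; rewrite /weight /= !size_cat !size_map doubleD.
by rewrite -[(size (leaves l)).*2]IHl -[(size (leaves r)).*2]IHr addSn addnS.
Qed.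

Lemma subtree_at_cat t p q : p ++ q \in nodes t ->
  subtree_at t (p ++ q) = subtree_at (subtree_at t p) q.
Proof.
elim: p t => [|b p IHp] [x|l r] //=.
by rewrite mem_nodes_Node; apply: IHp.
Qed.

Lemma cat_nodes t p q : p ++ q \in nodes t ->
  (p \in nodes t) && (q \in nodes (subtree_at t p)).
Proof.
elim: p t => [|b p IHp] t /=; first by rewrite root_nodes; case: t.
by case: t => [x|l r] //; rewrite !mem_nodes_Node; apply: IHp.
Qed.

Lemma leaves_subtree_at t p : {subset leaves (subtree_at t p) <= leaves t}.
Proof.
elim: t p => [x|l IHl r IHr] [|b p] //= x; rewrite mem_cat.
by case: b => [/IHr|/IHl] ->; rewrite ?orbT.
Qed.

Lemma leaves_prefix t p q : q \in nodes t -> prefix p q ->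
  {subset leaves (subtree_at t q) <= leaves (subtree_at t p)}.
Proof.
move=> qt /prefixP[s qE] x; rewrite qE in qt *.
by rewrite subtree_at_cat //; apply: leaves_subtree_at.
Qed.

Lemma weight_gt0 t : (0 < weight t)%N.
Proof. by elim: t => // l IHl r IHr; rewrite /weight /= size_cat addn_gt0 IHl. Qed.

Lemma leaves_neq0 t : exists x, x \in leaves t.
Proof.
have := weight_gt0 t; rewrite /weight; case: (leaves t) => // x s _.
by exists x; rewrite mem_head.
Qed.

Lemma uniq_subtree_at t p : uniq (leaves t) -> uniq (leaves (subtree_at t p)).
Proof.
elim: t p => [x|l IHl r IHr] [|b p] //=; rewrite cat_uniq => /and3P[ul _ ur].
by case: b; auto.
Qed.

(** The child of the root that [p] avoids has a leaf, and distinctness of the leaves keeps it out of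
    the subtree at [p]. *)
Lemma proper_subtree_at t p : uniq (leaves t) -> p \in nodes t -> p != [::] ->
  exists2 x, x \in leaves t & x \notin leaves (subtree_at t p).
Proof.
case: t p => [x|l r] [|b p] //=; rewrite cat_uniq => /and3P[_ /hasPn dlr _] _ _.
case: b.
  have [x xl] := leaves_neq0 l; exists x; first by rewrite mem_cat xl.
  by apply: contraL xl => /leaves_subtree_at/dlr.
have [x xr] := leaves_neq0 r; exists x; first by rewrite mem_cat xr orbT.
by apply: contra (dlr _ xr) => /leaves_subtree_at.
Qed.

(** Topmost nodes are described by recursion along the path, not by a quantifier over ancestors, so
    that proofs can follow the tree. The predicate is false on paths that leave the tree. *)
Fixpoint maximal_at (D : pred T) (t : tree T) (p : seq bool) : bool :=
  match t, p with
  | _, [::] => all D (leaves t)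
  | Node l r, b :: q =>
      ~~ all D (leaves t) && maximal_at D (if b then r else l) q
  | Leaf _, _ :: _ => false
  end.

Lemma maximal_at_all D t p : maximal_at D t p -> all D (leaves (subtree_at t p)).
Proof. by elim: t p => [x|l IHl r IHr] [|[] p] //= /andP[_]; auto. Qed.

Lemma maximal_at_intro D t p : p \in nodes t ->
  all D (leaves (subtree_at t p)) ->
  (forall q, prefix q p -> q != p -> ~~ all D (leaves (subtree_at t q))) ->
  maximal_at D t p.
Proof.
elim: p t => [|b p IHp] t pt Dp Dq; first by case: t pt Dp Dq.
case: t pt Dp Dq => [x|l r] //; rewrite mem_nodes_Node => pt Dp Dq /=.
rewrite [X in ~~ X](negbTE (Dq [::] _ _)) //=.
apply: IHp => // q qp nqp; apply: (Dq (b :: q)); first by rewrite prefix_cons eqxx.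
by rewrite eqseq_cons eqxx.
Qed.

Lemma maximal_at_antichain D t p q :
  maximal_at D t p -> maximal_at D t q -> prefix p q -> p = q.
Proof.
elim: p t q => [|b p IHp] [x|l r] [|c q] //=.
  by move=> ->.
move=> /andP[_ mp] /andP[_ mq] /andP[/eqP ebc pq].
by rewrite ebc in mp *; rewrite (IHp _ _ mp mq pq).
Qed.

(** The subtree at [p] fits into [D2] because it fits into [D1]; no proper ancestor fits into [D2]
    because none fits into [D3]. For nested rays, the bounds that make a fixed node canonical thus
    form an interval. *)
Lemma maximal_at_squeeze (D1 D2 D3 : pred T) t p :
    subpred D1 D2 -> subpred D2 D3 ->
  maximal_at D1 t p -> maximal_at D3 t p -> maximal_at D2 t p.
Proof.
move=> D12 D23; elim: p t => [|b p IHp] [x|l r] //=.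
- by rewrite !andbT => /D12.
- by move=> /(sub_all D12).
move=> /andP[_ m1] /andP[n3 m3]; rewrite (contra (@sub_all _ _ _ D23 _) n3) /=.
exact: IHp.
Qed.

Lemma maximal_at_none D t p : ~~ has D (leaves t) -> maximal_at D t p = false.
Proof.
move=> nD; apply: contraNF nD => /maximal_at_all/allP Dp.
have [x xp] := leaves_neq0 (subtree_at t p).
by apply/hasP; exists x; [apply: leaves_subtree_at xp | apply: Dp].
Qed.

(** Sums over the list of paths split along the two children, which sums over the finite type
    [node t] do not. *)
Lemma big_node (R : Type) (idx : R) (op : Monoid.com_law idx) t
    (P : pred (seq bool)) (F : seq bool -> R) :
  \big[op/idx]_(u : node t | P (val u)) F (val u) =
  \big[op/idx]_(p <- nodes t | P p) F p.
Proof.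
rewrite -[RHS](congr1 (fun s => \big[op/idx]_(p <- s | P p) F p)
                 (val_seq_sub_enum (uniq_nodes t))) big_map.
apply: perm_big.
apply: uniq_perm; first exact: index_enum_uniq.
  by rewrite -(map_inj_uniq val_inj) val_seq_sub_enum ?uniq_nodes.
by move=> u; rewrite mem_index_enum mem_seq_sub_enum.
Qed.

End Paths.

(** * Sorted trees: separation of nodes and canonical nodes *)

Section SearchTrees.
Variable K : realType.
Implicit Types (t : tree K) (p q : seq bool).

Lemma tree_max_mem t : tree_max t \in leaves t.
Proof.
by elim: t => [x|l IHl r IHr] /=; rewrite ?mem_head // mem_cat;
  case: leP; rewrite ?IHl ?IHr ?orbT.
Qed.

Lemma tree_min_mem t : tree_min t \in leaves t.
Proof.
by elim: t => [x|l IHl r IHr] /=; rewrite ?mem_head // mem_cat;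
  case: leP; rewrite ?IHl ?IHr ?orbT.
Qed.

Lemma tree_max_ge t x : x \in leaves t -> x <= tree_max t.
Proof.
elim: t => [y|l IHl r IHr] /=; first by rewrite inE => /eqP->.
by rewrite mem_cat le_max => /orP[/IHl|/IHr] ->; rewrite ?orbT.
Qed.

Lemma tree_min_le t x : x \in leaves t -> tree_min t <= x.
Proof.
elim: t => [y|l IHl r IHr] /=; first by rewrite inE => /eqP->.
by rewrite mem_cat ge_min => /orP[/IHl|/IHr] ->; rewrite ?orbT.
Qed.

Lemma sorted_Node (l r : tree K) : sorted <%R (leaves (Node l r)) =
  [&& allrel <%R (leaves l) (leaves r),
      sorted <%R (leaves l) & sorted <%R (leaves r)].
Proof. by rewrite !(sorted_pairwise lt_trans) pairwise_cat. Qed.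

(** Where the two paths diverge, one goes left and the other right, and sortedness orders the two
    sides. *)
Lemma incomparable_separated t p q : sorted <%R (leaves t) ->
    p \in nodes t -> q \in nodes t -> ~~ prefix p q -> ~~ prefix q p ->
  allrel <%R (leaves (subtree_at t p)) (leaves (subtree_at t q)) \/
  allrel <%R (leaves (subtree_at t q)) (leaves (subtree_at t p)).
Proof.
elim: p t q => [|b p IHp] [x|l r] [|c q] //.
rewrite sorted_Node !mem_nodes_Node !prefix_cons => /and3P[lr sl sr] pt qt.
case: (eqVneq b c) qt => [<-|nbc] qt; first by apply: IHp => //; case: (b).
move=> _ _.
have sub s o : allrel <%R (leaves (subtree_at l s)) (leaves (subtree_at r o)).
  by apply/allrelP => x y /leaves_subtree_at xl /leaves_subtree_at yr;
    apply: (allrelP lr).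
by case: b c nbc {pt qt} => [] [] //= _; [right | left].
Qed.

Lemma laminar_subtree_at t p q x : sorted <%R (leaves t) ->
    p \in nodes t -> q \in nodes t ->
  x \in leaves (subtree_at t p) -> x \in leaves (subtree_at t q) ->
  prefix p q || prefix q p.
Proof.
move=> st pt qt xp xq; apply/negPn/negP; rewrite negb_or => /andP[npq nqp].
by case: (incomparable_separated st pt qt npq nqp) => /allrelP H;
  have := H _ _ _ _; [move/(_ x x xp xq) | move/(_ x x xq xp)]; rewrite ltxx.
Qed.

Lemma maximal_at_separated (D : pred K) t p q : sorted <%R (leaves t) ->
    p \in nodes t -> q \in nodes t -> maximal_at D t p -> maximal_at D t q ->
  p != q ->
  allrel <%R (leaves (subtree_at t p)) (leaves (subtree_at t q)) \/
  allrel <%R (leaves (subtree_at t q)) (leaves (subtree_at t p)).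
Proof.
move=> st pt qt mp mq npq; apply: incomparable_separated => //.
  by apply: contra npq => /(maximal_at_antichain mp mq) ->.
by apply: contra npq => /(maximal_at_antichain mq mp) ->.
Qed.

(* A minimum representation contains no [v] whose proper ancestor [p] is also
   inside [I]: [p] has an element outside [P_v], covered by some [w] comparable
   with [p], and the larger of [p] and [w] can replace both [v] and [w]. *)
Lemma canonical_nodes_maximal t (I : interval K) (v : node t) :
  sorted <%R (leaves t) -> v \in canonical_nodes t I ->
  maximal_at (fun x => x \in I) t (val v).
Proof.
move=> st; have ut := lt_sorted_uniq st.
(* If the choice fails, the default [set0] cannot contain [v]. *)
rewrite /canonical_nodes; case: pickP => [A|_] /=; last by rewrite inE.
move=> /andP[/eqP AE /forallP Amin] vA.
have repP (C : {set node t}) x :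
    reflect (exists2 u, u \in C & x \in leaves (subtree u))
      (x \in (\bigcup_(u in C) canonical_subset u)%fset).
  apply: (iffP (bigfcupP _ _ _ _)) => -[u].
    by rewrite !inE /= mem_index_enum /= => uC xu; exists u.
  by move=> uC xu; exists u; rewrite ?mem_index_enum ?uC // !inE.
have AI u x : u \in A -> x \in leaves (subtree u) -> x \in I.
  move=> uA xu; have : x \in (\bigcup_(u in A) canonical_subset u)%fset.
    by apply/repP; exists u.
  by rewrite AE !inE /= => /andP[].
have cover x : x \in leaves t -> x \in I ->
    exists2 u, u \in A & x \in leaves (subtree u).
  by move=> xt xI; apply/repP; rewrite AE !inE /= xt.
apply: maximal_at_intro; first exact: valP.
  by apply/allP => x xv; apply: AI xv.
move=> p pv npv; apply/negP => /allP pI.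
have vt : val v \in nodes t := valP v.
have [s vE] : exists s, val v = p ++ s by apply/prefixP.
have /andP[pt sp] : (p \in nodes t) && (s \in nodes (subtree_at t p)).
  by apply: cat_nodes; rewrite -vE.
have [x xp] : exists2 x,
    x \in leaves (subtree_at t p) & x \notin leaves (subtree v).
  rewrite /subtree vE subtree_at_cat -?vE //; apply: proper_subtree_at => //.
    exact: uniq_subtree_at.
  by apply: contra npv => /eqP s0; rewrite vE s0 cats0.
move=> xNv; have [w wA xw] := cover x (leaves_subtree_at xp) (pI x xp).
have wt : val w \in nodes t := valP w.
have [z [zv zw zI]] : exists z : node t,
    [/\ {subset leaves (subtree v) <= leaves (subtree z)},
        {subset leaves (subtree w) <= leaves (subtree z)} &
        {in leaves (subtree z), forall y, y \in I}].
  case/orP: (laminar_subtree_at st pt wt xp xw) => [pw|wp].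
    exists (SeqSub pt); split; [exact: leaves_prefix|exact: leaves_prefix|exact: pI].
  exists w; split => // [|y]; last exact: AI.
  by apply: leaves_prefix => //; apply: prefix_trans pv.
have nvw : v != w by apply: contraNneq xNv => ->.
have /implyP := Amin (z |: (A :\ v :\ w)).
have -> : represents I (z |: (A :\ v :\ w)).
  rewrite /represents -AE; apply/eqP/fsetP => y; apply/repP/repP => -[u].
    rewrite !inE => /orP[/eqP-> yz|/and3P[_ _ uA] yu]; last by exists u.
    by apply: cover; [apply: leaves_subtree_at yz | apply: zI].
  move=> uA yu.
  have [uv|nuv] := eqVneq u v; first by exists z; rewrite ?setU11 // zv -?uv.
  have [uw|nuw] := eqVneq u w; first by exists z; rewrite ?setU11 // zw -?uw.
  by exists u => //; rewrite !inE nuv nuw uA orbT.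
move=> /(_ isT); rewrite cardsU1 (cardsD1 v A) vA (cardsD1 w (A :\ v)).
rewrite !inE eq_sym nvw wA /= !add1n.
(* Two nodes are removed and at most one is added, whether or not [z] was already present, so the
   new representation is strictly smaller. *)
by case: (~~ _); rewrite /= ?add0n ?add1n ?ltnn // ltnNge leqnSn.
Qed.

(** An abstraction of rays in either direction: of two separated lists, at most one is cut by the
    end of the ray. Hence only one child of a node calls for a recursive estimate. *)
Definition one_sided (D : pred K) := forall s1 s2, allrel <%R s1 s2 ->
  [|| all D s1, all D s2, ~~ has D s1 | ~~ has D s2].

Lemma one_sided_le (b : K) : one_sided (fun x => x \in `]-oo, b]).
Proof.
move=> s1 s2 /allrelP s12; have [//|/allPn[x xs1 xb]] := boolP (all _ s1).
apply/or4P/Or44; apply/hasPn => y ys2; rewrite !in_itv /= -!ltNge in xb *.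
exact: lt_trans xb (s12 _ _ xs1 ys2).
Qed.

Lemma one_sided_ge (a : K) : one_sided (fun x => x \in `[a, +oo[).
Proof.
move=> s1 s2 /allrelP s12.
have [|/allPn[x xs2 xa]] := boolP (all _ s2); rewrite ?orbT //.
apply/or4P/Or43; apply/hasPn => y ys1; rewrite !in_itv /= !andbT -!ltNge in xa *.
exact: lt_trans (s12 _ _ ys1 xs2) xa.
Qed.

(** * Sums of inverse weights over canonical nodes of a balanced tree *)

Lemma balance_weight (alpha : K) (l r : tree K) :
    alpha <= balance l r <= 1 - alpha ->
  alpha * ((weight l)%:R + (weight r)%:R) <= (weight l)%:R /\
  alpha * ((weight l)%:R + (weight r)%:R) <= (weight r)%:R.
Proof.
have l0 : 0 < (weight l)%:R :> K by rewrite ltr0n weight_gt0.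
have r0 : 0 < (weight r)%:R :> K by rewrite ltr0n weight_gt0.
rewrite /balance natrD ler_pdivlMr ?ler_pdivrMr ?addr_gt0 // => /andP[-> h].
by split=> //; lra.
Qed.

Definition maximal_invweight (D : pred K) t : K :=
  \sum_(p <- nodes t | maximal_at D t p) ((weight (subtree_at t p))%:R)^-1.

Lemma maximal_invweight_all (D : pred K) t : all D (leaves t) ->
  maximal_invweight D t = (weight t)%:R^-1.
Proof.
move=> Dt; rewrite /maximal_invweight; case: t Dt => [x|l r] /= Dt.
  by rewrite big_cons big_nil Dt addr0.
rewrite big_cons Dt big1_seq ?addr0 //.
by move=> p /andP[pD]; rewrite mem_cat => /orP[] /mapP[q _ pE]; rewrite pE in pD.
Qed.

Lemma maximal_invweight_none (D : pred K) t : ~~ has D (leaves t) ->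
  maximal_invweight D t = 0.
Proof.
by move=> nD; rewrite /maximal_invweight big1 // => p; rewrite maximal_at_none.
Qed.

Lemma maximal_invweight_Node (D : pred K) (l r : tree K) :
  ~~ all D (leaves (Node l r)) ->
  maximal_invweight D (Node l r) =
    maximal_invweight D l + maximal_invweight D r.
Proof.
by move=> nD; rewrite /maximal_invweight /= big_cons (negbTE nD) big_cat !big_map.
Qed.

(* One step of the induction below: replacing a tree of weight [y] by a parent
   of weight [x + y] pays for one new maximal node of weight [x]. *)
Lemma invweight_step (alpha x y : K) : 0 < alpha -> 0 < x -> 0 < y ->
    alpha * (x + y) <= x ->
  x^-1 + ((1 + alpha ^- 2) - alpha ^- 2 / y) <=
  (1 + alpha ^- 2) - alpha ^- 2 / (x + y).
Proof.
move=> a0 x0 y0 h; have xy0 : 0 < x + y by rewrite addr_gt0.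
rewrite -subr_ge0.
have -> : 1 + alpha ^- 2 - alpha ^- 2 / (x + y) -
    (x^-1 + (1 + alpha ^- 2 - alpha ^- 2 / y)) =
    (x ^+ 2 - alpha ^+ 2 * y * (x + y)) / (alpha ^+ 2 * x * y * (x + y)).
  by field; rewrite !gt_eqF.
apply: divr_ge0; last by rewrite !mulr_ge0 ?exprn_ge0 ?ltW.
(* The balance hypothesis squared bounds this middle term by [x ^+ 2]. *)
rewrite subr_ge0; apply: (@le_trans _ _ ((alpha * (x + y)) ^+ 2)).
  have -> : (alpha * (x + y)) ^+ 2 =
      alpha ^+ 2 * y * (x + y) + alpha ^+ 2 * x * (x + y) by ring.
  by rewrite lerDl !mulr_ge0 ?exprn_ge0 ?ltW.
by apply: lerXn2r h; rewrite nnegrE ltW // mulr_gt0.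
Qed.

Lemma invweight_mono (alpha x y : K) : 0 < alpha -> 0 < x -> 0 < y ->
  (1 + alpha ^- 2) - alpha ^- 2 / y <= (1 + alpha ^- 2) - alpha ^- 2 / (x + y).
Proof.
move=> a0 x0 y0; rewrite lerD2l lerN2 ler_wpM2l //.
  by rewrite invr_ge0 exprn_ge0 // ltW.
by rewrite lef_pV2 ?posrE ?addr_gt0 // lerDr ltW.
Qed.

(** The subtracted term strengthens the induction and replaces a geometric series. At a node not
    inside [D], one child is either inside [D], adding a single inverse weight paid for by
    [invweight_step], or disjoint from [D], adding nothing. A leaf inside [D] attains equality. *)
Lemma maximal_invweight_bound (alpha : K) (D : pred K) t : 0 < alpha ->
    one_sided D -> sorted <%R (leaves t) -> tree_bb alpha t ->
  maximal_invweight D t <= (1 + alpha ^- 2) - alpha ^- 2 / (weight t)%:R.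
Proof.
move=> a0 oD; have c0 : 0 <= alpha ^- 2 by rewrite invr_ge0 exprn_ge0 // ltW.
elim: t => [x|l IHl r IHr].
  by rewrite /maximal_invweight big_cons big_nil /weight /= divr1 invr1;
    case: ifP; lra.
have w0 (t : tree K) : 0 < (weight t)%:R :> K by rewrite ltr0n weight_gt0.
rewrite sorted_Node => /and3P[lr sl sr] /= /and3P[/balance_weight[bl br] tl tr].
have [/maximal_invweight_all ->|nD] := boolP (all D (leaves (Node l r))).
  (* With [z] the inverse weight, the slack is [(1 + alpha ^- 2) * (1 - z)]. *)
  have : (weight (Node l r))%:R^-1 <= 1 :> K by rewrite invf_le1 // ler1n weight_gt0.
  have : 0 < (weight (Node l r))%:R^-1 :> K by rewrite invr_gt0.
  set z := _^-1 => z0 z1; have : alpha ^- 2 * z <= alpha ^- 2 by rewrite ler_piMr.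
  lra.
rewrite maximal_invweight_Node //.
have -> : (weight (Node l r))%:R = (weight l)%:R + (weight r)%:R :> K.
  by rewrite /weight size_cat natrD.
case/or4P: (oD _ _ lr) =>
  [Dl|Dr|/maximal_invweight_none->|/maximal_invweight_none->].
- rewrite (maximal_invweight_all Dl).
  by apply: le_trans (invweight_step a0 (w0 l) (w0 r) bl); rewrite lerD2l IHr.
- rewrite (maximal_invweight_all Dr) (addrC (maximal_invweight D l)).
  rewrite (addrC (weight l)%:R).
  apply: le_trans (invweight_step a0 (w0 r) (w0 l) _); last by rewrite addrC.
  by rewrite lerD2l IHl.
- by rewrite add0r (le_trans (IHr sr tr)) // invweight_mono.
- by rewrite addr0 (le_trans (IHl sl tl)) // (addrC (weight l)%:R) invweight_mono.
Qed.

(** * Counting the partners of a node *)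

(** Double counting: topmost nodes form an antichain, so each leaf lies below at most one node of
    [V], and such a leaf satisfies [N]. *)
Lemma sum_weight_maximal (D N : pred K) t (V : {set node t}) :
    sorted <%R (leaves t) ->
    {in V, forall v, maximal_at D t (val v)} ->
    {in V, forall v, {in leaves (subtree v), forall x, N x}} ->
  (\sum_(v in V) weight (subtree v) <= count N (leaves t))%N.
Proof.
move=> st VD VN; have ut := lt_sorted_uniq st.
have wE (v : node t) : (weight (subtree v) <=
    \sum_(b <- leaves t) (b \in leaves (subtree v)))%N.
  rewrite -big_mkcond sum1_count -size_filter.
  apply: uniq_leq_size; first exact: uniq_subtree_at.
  by move=> x xv; rewrite mem_filter /= xv (leaves_subtree_at xv).
apply: (@leq_trans (\sum_(v in V)
    \sum_(b <- leaves t) (b \in leaves (subtree v)))).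
  by apply: leq_sum => v _; apply: wE.
rewrite exchange_big -sum1_count /= [leqRHS]big_mkcond /=.
apply: leq_sum => b _.
have [v /andP[vV bv]|none] :=
    pickP (fun v => (v \in V) && (b \in leaves (subtree v))).
  rewrite (bigD1 v) //= big1 => [|w /andP[wV nwv]].
    by rewrite (VN v vV b bv) bv.
  apply/eqP; rewrite eqb0; apply: contra nwv => bw; apply/eqP/val_inj.
  have /orP[] := laminar_subtree_at st (valP w) (valP v) bw bv.
    exact: maximal_at_antichain (VD w wV) (VD v vV).
  by move=> /(maximal_at_antichain (VD v vV) (VD w wV)) ->.
rewrite big1 // => v vV; apply/eqP; rewrite eqb0.
by have := none v; rewrite vV /= => ->.
Qed.

Lemma card_heavy_maximal (D N : pred K) t (V : {set node t}) (w : nat)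
    (v0 : node t) :
    sorted <%R (leaves t) -> (0 < w)%N ->
    {in V, forall v, maximal_at D t (val v)} ->
    {in V, forall v, (w <= weight (subtree v))%N} ->
    {in V, forall v, v != v0 -> {in leaves (subtree v), forall x, N x}} ->
  #|V|%:R <= 1 + (count N (leaves t))%:R / w%:R :> K.
Proof.
move=> st w0 VD Vw VN.
have : (#|V :\ v0| * w <= count N (leaves t))%N.
  apply: leq_trans (sum_weight_maximal st (D := D) (V := V :\ v0) _ _).
  - by rewrite -sum_nat_const leq_sum // => v /setD1P[_ /Vw].
  - by move=> v /setD1P[_ /VD].
  - by move=> v /setD1P[nv vV]; apply: VN.
rewrite -(ler_nat K) natrM -ler_pdivlMr ?ltr0n // => h.
rewrite (cardsD1 v0) natrD lerD //.
(* The exceptional node [v0] contributes at most one, in [V] or not. *)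
by case: (_ \in _); rewrite ?lexx ?ler01.
Qed.

(* [D b] is the ray bounded by [b] for which nodes of [t1] are canonical. The
   sets [V u] collect the partners of [u] that are at least as heavy as [u];
   all but one of them lie among the [b] having [u] as a canonical node, and
   [maximal_invweight_bound] controls the sum over [u] for each such [b]. *)
Lemma sum_card_heavy_partners (alpha : K) (t1 t2 : tree K) (D : K -> pred K)
    (V : node t1 -> {set node t2}) (E : node t1 -> pred K) : 0 < alpha ->
    (forall b, one_sided (D b)) ->
    sorted <%R (leaves t1) -> tree_bb alpha t1 -> sorted <%R (leaves t2) ->
    (forall u, {in V u, forall v, maximal_at (E u) t2 (val v)}) ->
    (forall u, {in V u, forall v,
       (weight (subtree u) <= weight (subtree v))%N}) ->
    (forall u, V u != set0 -> exists v0, {in V u, forall v, v != v0 ->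
       {in leaves (subtree v), forall x, maximal_at (D x) t1 (val u)}}) ->
  (\sum_u #|V u|)%:R <=
    2 * (weight t1)%:R + (1 + alpha ^- 2) * (weight t2)%:R :> K.
Proof.
move=> a0 oD s1 bb1 s2 VE Vw VD.
have card_le u : #|V u|%:R <= 1 +
    \sum_(b <- leaves t2 | maximal_at (D b) t1 (val u))
      (weight (subtree_at t1 (val u)))%:R^-1 :> K.
  rewrite big_const_seq iter_addr_0 -[X in 1 + X]mulr_natl.
  (* An exceptional node is only provided when [V u] is nonempty. *)
  have [->|/VD[v0 Hv0]] := eqVneq (V u) set0.
    by rewrite cards0 addr_ge0 ?mulr_ge0 ?invr_ge0.
  by apply: card_heavy_maximal (VE u) (Vw u) Hv0; rewrite ?weight_gt0.
rewrite natr_sum; apply: le_trans (ler_sum _ (fun u _ => card_le u)) _.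
(* The ones add up to the number of nodes of [t1], below twice its weight; the remaining double sum
   is exchanged to run over [b] first. *)
rewrite big_split /= lerD //.
  rewrite sumr_const card_seq_sub ?uniq_nodes // -natrM ler_nat mul2n.
  by rewrite -size_nodes.
rewrite (exchange_big_dep predT) //=.
apply: (@le_trans _ _ (\sum_(b <- leaves t2) (1 + alpha ^- 2))).
  apply: ler_sum => b _.
  rewrite (big_node _ t1 (maximal_at (D b) t1)
    (fun p => (weight (subtree_at t1 p))%:R^-1)).
  apply: le_trans (maximal_invweight_bound a0 (oD b) s1 bb1) _.
  by rewrite gerBl divr_ge0 ?invr_ge0 ?exprn_ge0 // ltW.
by rewrite big_const_seq iter_addr_0 count_predT mulr_natr.
Qed.

(** * Charging links to their lighter endpoints *)

Lemma num_links_bound (alpha : K) (tR tB : tree K) : 0 < alpha ->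
    sorted <%R (leaves tR) -> tree_bb alpha tR ->
    sorted <%R (leaves tB) -> tree_bb alpha tB ->
  (num_links (Some tR) (Some tB))%:R <=
    (3 + alpha ^- 2) * ((weight tR)%:R + (weight tB)%:R) :> K.
Proof.
move=> a0 sR bR sB bB.
(* Links between nodes of equal weight are charged to both ends, which is harmless for an upper
   bound. *)
pose VB u := [set v : node tB | @linked K tR tB u v &
                (weight (subtree u) <= weight (subtree v))%N].
pose VR v := [set u : node tR | @linked K tR tB u v &
                (weight (subtree v) <= weight (subtree u))%N].
have linkB u v : @linked K tR tB u v ->
    maximal_at (fun x => x \in `[tree_max (subtree u), +oo[) tB (val v).
  by case/andP => /(canonical_nodes_maximal sB).
have linkR u v : @linked K tR tB u v ->
    maximal_at (fun x => x \in `]-oo, tree_min (subtree v)]) tR (val u).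
  by case/andP => _ /(canonical_nodes_maximal sR).
have HB : (\sum_u #|VB u|)%:R <=
    2 * (weight tR)%:R + (1 + alpha ^- 2) * (weight tB)%:R :> K.
  apply: (sum_card_heavy_partners a0 one_sided_le
    (E := fun u x => x \in `[tree_max (subtree u), +oo[)) => // [u v|u v|u].
  - by rewrite inE => /andP[/linkB].
  - by rewrite inE => /andP[].
  case/set0Pn => v1 v1V.
  (* The exceptional partner [v0] is the rightmost one. For [x] below another partner [v], the ray
     up to [x] lies between those up to [b_v] and [b_v0], for both of which [u] is canonical, so
     squeezing applies. *)
  case: (arg_maxP (fun v : node tB => tree_min (subtree v)) v1V) => v0 v0V v0max.
  exists v0 => v vV nv x xv.
  have vle : tree_min (subtree v) <= tree_min (subtree v0) by exact: v0max.
  have {}v0V : v0 \in VB u by [].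
  move: v0V vV; rewrite !inE => /andP[l0 _] /andP[l _].
  apply: maximal_at_squeeze (linkR _ _ l) (linkR _ _ l0) => y;
    rewrite !in_itv /=.
    by move/le_trans; apply; apply: tree_min_le.
  move/le_trans; apply.
  (* The two partners are separated, and the choice of [v0] excludes that [v0] lies to the left of
     [v]. *)
  have [] :=
    maximal_at_separated sB (valP v) (valP v0) (linkB _ _ l) (linkB _ _ l0) nv.
    by move/allrelP => /(_ x _ xv (tree_min_mem (subtree v0)))/ltW.
  move/allrelP => /(_ _ _ (tree_min_mem (subtree v0)) (tree_min_mem (subtree v))).
  by rewrite ltNge vle.
have HR : (\sum_v #|VR v|)%:R <=
    2 * (weight tB)%:R + (1 + alpha ^- 2) * (weight tR)%:R :> K.
  apply: (sum_card_heavy_partners a0 one_sided_ge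
    (E := fun v x => x \in `]-oo, tree_min (subtree v)])) => // [v u|v u|v].
  - by rewrite inE => /andP[/linkR].
  - by rewrite inE => /andP[].
  case/set0Pn => u1 u1V.
  (* In the mirrored argument the exceptional partner is the leftmost one. *)
  case: (arg_minP (fun u : node tR => tree_max (subtree u)) u1V) => u0 u0V u0min.
  exists u0 => u uV nu x xu.
  have uge : tree_max (subtree u0) <= tree_max (subtree u) by exact: u0min.
  have {}u0V : u0 \in VR v by [].
  move: u0V uV; rewrite !inE => /andP[l0 _] /andP[l _].
  apply: maximal_at_squeeze (linkB _ _ l) (linkB _ _ l0) => y;
    rewrite !in_itv /= !andbT.
    by apply: le_trans; apply: tree_max_ge.
  apply: le_trans.
  have [] :=
    maximal_at_separated sR (valP u) (valP u0) (linkR _ _ l) (linkR _ _ l0) nu.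
    move/allrelP => /(_ _ _ (tree_max_mem (subtree u))
      (tree_max_mem (subtree u0))).
    by rewrite ltNge uge.
  by move/allrelP => /(_ _ x (tree_max_mem (subtree u0)) xu)/ltW.
have le_links : (num_links (Some tR) (Some tB) <=
    \sum_u #|VB u| + \sum_v #|VR v|)%N.
  rewrite /num_links -sum1_card.
  (* All three counts become sums of indicators over pairs, compared pair by pair. *)
  under [X in (_ <= X + _)%N]eq_bigr => u _ do rewrite -sum1_card big_mkcond.
  under [X in (_ <= _ + X)%N]eq_bigr => v _ do rewrite -sum1_card big_mkcond.
  rewrite [X in (_ <= _ + X)%N]exchange_big /= !pair_big /= -big_split /=.
  rewrite big_mkcond; apply: leq_sum => -[u v] _; rewrite !inE /=.
  case: linked => //=.
  by have /orP[] := leq_total (weight (subtree u)) (weight (subtree v)) => ->;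
    rewrite ?leq_addr ?leq_addl.
move: le_links; rewrite -(ler_nat K) natrD => /le_trans; apply.
have : 0 <= alpha ^- 2 by rewrite invr_ge0 exprn_ge0 // ltW.
(* Adding [HB] and [HR] gives each tree the coefficient [2 + (1 + alpha ^- 2)]. *)
lra.
Qed.

End SearchTrees.

Theorem theorem16 (K : realType) (alpha : K)
    (alpha_gt0 : 0 < alpha) (alpha_le_half : alpha <= 2^-1) :
  exists c : nat, forall (R B : {fset K}) (TR TB : option (tree K)),
    range_tree R TR -> bb alpha TR ->
    range_tree B TB -> bb alpha TB ->
    (num_links TR TB <= c * (#|` R| + #|` B|))%N.
Proof.
have c0 : 0 <= 3 + alpha ^- 2 by rewrite addr_ge0 // invr_ge0 exprn_ge0 // ltW.
(* The real constant is rounded up to a natural number depending on [alpha] only. If either tree is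
   empty there are no links. *)
exists (Num.bound (3 + alpha ^- 2)) => R B [tR|] [tB|] //= [sR RE] bR [sB BE] bB.
have cardE (S : {fset K}) (t : tree K) :
    sorted <%R (leaves t) -> leaves t =i S -> #|` S| = weight t.
  move=> st tS; apply/perm_size/uniq_perm => [||x]; rewrite ?tS //.
  exact: lt_sorted_uniq.
rewrite (cardE _ _ sR RE) (cardE _ _ sB BE) -(ler_nat K) natrM natrD.
apply: le_trans (num_links_bound alpha_gt0 sR bR sB bB) _.
by rewrite ler_wpM2r ?addr_ge0 // ltW // archi_boundP.
Qed.
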